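(* Let $\lambda$ be a nonzero real number, let $r\ge 1$ be an integer, and let $x\in\mathbb{R}$. For every integer $n\ge 0$, $$D_{n,\lambda}^{(r)}(x)=\sum_{k=0}^{n}\beta_{k,\lambda}^{(r)}(x)\,S_{1,\lambda}(n,k).$$
   Context: Generating functions are power series in $t$ (formal, or convergent for $|t|$ small), with $(1+t)^{x}=\sum_{n\ge 0}(x)_n\frac{t^n}{n!}$, where $(x)_0=1$ and $(x)_n=x(x-1)\cdots(x-n+1)$ for $n\ge1$. Also $(x)_{0,\lambda}=1$ and $(x)_{n,\lambda}=x(x-\lambda)\cdots(x-(n-1)\lambda)$ for $n\ge 1$, and $(1+\lambda t)^{x/\lambda}=\sum_{n\ge0}(x)_{n,\lambda}\frac{t^n}{n!}$. The degenerate logarithm is $\log_\lambda(1+t)=\frac{1}{\lambda}\left((1+t)^\lambda-1\right)$. The degenerate Daehee polynomials of order $r$ are defined by $$\sum_{n=0}^{\infty}D_{n,\lambda}^{(r)}(x)\frac{t^{n}}{n!}=\left(\frac{\log(1+t)}{t}\right)^{r}\int_{0}^{1}\cdots\int_{0}^{1}(1+t)^{\lambda(x_{1}+\cdots+x_{r})+x}dx_{1}\cdots dx_{r}=\left(\frac{\log_{\lambda}(1+t)}{t}\right)^{r}(1+t)^{x}.$$ The degenerate Bernoulli polynomials of order $r$ are defined by $\left(\frac{t}{(1+\lambda t)^{1/\lambda}-1}\right)^{r}(1+\lambda t)^{x/\lambda}=\sum_{n=0}^\infty\beta_{n,\lambda}^{(r)}(x)\frac{t^n}{n!}$. The degenerate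 Stirling numbers of the first kind $S_{1,\lambda}(n,l)$ are defined by the polynomial identity in $x$: $(x)_n=\sum_{l=0}^n S_{1,\lambda}(n,l)(x)_{l,\lambda}$ for $n\ge0$. *)

(* Defs.v *)
From HB Require Import structures.
From mathcomp Require Import all_boot all_order all_algebra.
From mathcomp Require Import ring.
From mathcomp Require Import reals.

Set Implicit Arguments.
Unset Strict Implicit.
Unset Printing Implicit Defensive.

Import Order.TTheory GRing.Theory Num.Theory.

Local Open Scope ring_scope.

(* [(x)_n] and [(x)_{n,lam}], over any commutative ring so that they can be    *)
(* used both at a scalar and at the polynomial variable ['X].                  *)
Definition falling (A : comNzRingType) (x : A) (n : nat) : A :=
  \prod_(i < n) (x - i%:R).

Definition dfalling (A : comNzRingType) (lam x : A) (n : nat) : A :=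
  \prod_(i < n) (x - i%:R * lam).

(* A formal power series [\sum_n a_n t^n] is its sequence of coefficients.     *)
Definition fps (R : Type) : Type := nat -> R.

Section FormalPowerSeries.

Variable R : numFieldType.
Implicit Types (a b : fps R) (n : nat).

Definition fps_one : fps R := fun n => (n == 0%N)%:R.

Definition fps_sub a b : fps R := fun n => a n - b n.

Definition fps_scale (c : R) a : fps R := fun n => c * a n.

Definition fps_mul a b : fps R := fun n => \sum_(i < n.+1) a i * b (n - i)%N.

Definition fps_exp a (r : nat) : fps R := iter r (fps_mul a) fps_one.

(* [a / t]; meaningful when the constant term of [a] is zero.                  *)
Definition fps_divt a : fps R := fun n => a n.+1.

(* The first [n.+1] coefficients of [1 / a], from                              *)
(* [b_0 = 1 / a_0] and [a_0 b_n = - (a_1 b_(n-1) + ... + a_n b_0)].            *)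
Fixpoint fps_inv_rec a n : seq R :=
  if n is m.+1 then
    let b := fps_inv_rec a m in
    rcons b (- (a 0%N)^-1 * \sum_(i < m.+1) a i.+1 * b`_(m - i))
  else [:: (a 0%N)^-1].

Definition fps_inv a : fps R := fun n => (fps_inv_rec a n)`_n.

Lemma size_fps_inv_rec a n : size (fps_inv_rec a n) = n.+1.
Proof. by elim: n => //= n IHn; rewrite size_rcons IHn. Qed.

Lemma nth_fps_inv_rec a n k :
  (k <= n)%N -> (fps_inv_rec a n)`_k = fps_inv a k.
Proof.
elim: n => [|n IHn]; first by rewrite leqn0 => /eqP->.
rewrite leq_eqVlt => /orP[/eqP-> //|]; rewrite ltnS => lekn /=.
by rewrite nth_rcons size_fps_inv_rec ltnS lekn IHn.
Qed.

Lemma fps_mulrV a : a 0%N != 0 -> fps_mul a (fps_inv a) =1 fps_one.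
Proof.
move=> a0 [|n]; rewrite /fps_mul /fps_one.
  by rewrite big_ord_recl big_ord0 addr0 /= mulfV.
rewrite big_ord_recl subn0 {1}/fps_inv /= nth_rcons size_fps_inv_rec ltnn eqxx.
rewrite mulrA mulrN mulfV // mulN1r; apply/eqP; rewrite addrC subr_eq0.
by apply/eqP/eq_bigr => i _; rewrite subSS nth_fps_inv_rec ?leq_subr.
Qed.

(* [(1 + t)^x] *)
Definition pow1p (x : R) : fps R := fun n => falling x n / n`!%:R.

(* [(1 + lam t)^(x / lam)] *)
Definition dpow1p (lam x : R) : fps R := fun n => dfalling lam x n / n`!%:R.

(* [log_lam (1 + t) = ((1 + t)^lam - 1) / lam] *)
Definition dlog1p (lam : R) : fps R :=
  fps_scale lam^-1 (fps_sub (pow1p lam) fps_one).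

(* The sequence with exponential generating function [a].                      *)
Definition egf_coef a n : R := n`!%:R * a n.

(* Daehee: [(log_lam (1 + t) / t)^r (1 + t)^x] *)
Definition degenerate_daehee (lam : R) (r n : nat) (x : R) : R :=
  egf_coef (fps_mul (fps_exp (fps_divt (dlog1p lam)) r) (pow1p x)) n.

(* Bernoulli: [(t / ((1 + lam t)^(1 / lam) - 1))^r (1 + lam t)^(x / lam)],     *)
(* where [t / f] is the inverse of the series [f / t].                         *)
Definition degenerate_bernoulli (lam : R) (r n : nat) (x : R) : R :=
  egf_coef
    (fps_mul
       (fps_exp (fps_inv (fps_divt (fps_sub (dpow1p lam 1) fps_one))) r)
       (dpow1p lam x)) n.

(* [S] is a family of degenerate Stirling numbers of the first kind: the       *)
(* defining identity, in [{poly R}].  It determines [S n l] for [l <= n] and   *)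
(* leaves the other values free.                                               *)
Definition degenerate_stirling1 (lam : R) (S : nat -> nat -> R) : Prop :=
  forall n : nat,
    falling ('X : {poly R}) n =
    \sum_(l < n.+1) S n l *: dfalling lam%:P ('X : {poly R}) l.

Lemma size_dfalling (lam : R) n :
  size (dfalling lam%:P ('X : {poly R}) n) = n.+1.
Proof.
rewrite /dfalling; under eq_bigr do rewrite -polyC_natr -polyCM.
by rewrite size_prod_XsubC /index_enum -enumT size_enum_ord.
Qed.

Lemma degenerate_stirling1_exists (lam : R) :
  exists S, degenerate_stirling1 lam S.
Proof.
pose fix S (n l : nat) {struct n} : R :=
  if n is m.+1 then
    (if l is k.+1 then S m k else 0) + (l%:R * lam - m%:R) * S m l
  else (l == 0%N)%:R.
have S0 n l : (n < l)%N -> S n l = 0.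
  elim: n l => [|n IHn] [|l] //= ltnl.
  by rewrite !IHn ?mulr0 ?addr0 // ltnW.
exists S; elim=> [|n IHn].
  by rewrite big_ord1 /falling /dfalling !big_ord0 scale1r.
rewrite /falling big_ord_recr /= -/(falling _ n) IHn mulr_suml.
under [RHS]eq_bigr do rewrite scalerDl.
rewrite [RHS]big_split [X in _ = X + _]big_ord_recl /= scale0r add0r.
rewrite [X in _ = _ + X]big_ord_recr /= (S0 n n.+1) // mulr0 scale0r addr0.
rewrite -big_split; apply: eq_bigr => i _ /=.
rewrite /bump /= add1n [dfalling _ _ i.+1]big_ord_recr /= -/(dfalling _ _ i).
rewrite -!mul_polyC !polyCM polyCB polyCM !polyC_natr.
by ring.
Qed.

Lemma dfalling_free (lam : R) (c : nat -> R) n :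
  \sum_(l < n) c l *: dfalling lam%:P ('X : {poly R}) l = 0 ->
  forall l, (l < n)%N -> c l = 0.
Proof.
elim: n => [|n IHn] // sum0.
have cn0 : c n = 0.
  apply/eqP; apply: contraTT isT => cn_neq0.
  have := congr1 (fun p : {poly R} => size p) sum0.
  rewrite size_poly0 big_ord_recr /= addrC size_polyDl size_scale ?size_dfalling //.
  rewrite ltnS; apply: leq_trans (size_sum _ _ _) _; apply/bigmax_leqP => i _.
  by rewrite (leq_trans (size_scale_leq _ _)) // size_dfalling.
move: sum0; rewrite big_ord_recr /= cn0 scale0r addr0 => /IHn c0 l.
by rewrite ltnS leq_eqVlt => /orP[/eqP-> //|/c0].
Qed.

Lemma degenerate_stirling1_unique (lam : R) (S S' : nat -> nat -> R) :
  degenerate_stirling1 lam S -> degenerate_stirling1 lam S' ->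
  forall n l, (l <= n)%N -> S n l = S' n l.
Proof.
move=> HS HS' n l leln; apply/eqP; rewrite -subr_eq0; apply/eqP.
apply: (@dfalling_free lam (fun l => S n l - S' n l) n.+1) => //.
under eq_bigr do rewrite scalerBl.
by rewrite sumrB -HS -HS' subrr.
Qed.

End FormalPowerSeries.

(* Main.v *)
Require Import Defs.
From HB Require Import structures.
From mathcomp Require Import all_boot all_order all_algebra.
From mathcomp Require Import ring.
From mathcomp Require Import reals.

(** The identity is a change of variable [t := log_lam (1 + t)].  Attach to a
    family [S] of degenerate Stirling numbers the operator [stirling_subst S]
    on power series whose action on exponential coefficients is the matrix
    [S n k].  Evaluated at a scalar [x], the polynomial identity defining [S]
    says that this operator sends [(1 + lam t)^(x / lam)] to [(1 + t)^x]
    ([stirling_subst_dpow1p]).  Everything else is deduced from this.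

    The operator is multiplicative ([stirling_substM]): on two series of the
    form [(1 + lam t)^(x / lam)] this is the law of exponents on both sides
    ([dpow1pD], [pow1pD]), and in each fixed degree, by bilinearity, these
    series suffice, because their truncations span all truncated series
    ([dpow1p_total]).

    It sends [t = ((1 + lam t)^(lam / lam) - 1) / lam] to
    [((1 + t)^lam - 1) / lam = log_lam (1 + t)], and [(1 + lam t)^(1 / lam) - 1]
    to [(1 + t) - 1 = t].  So applying it to
    [((1 + lam t)^(1 / lam) - 1) B = t], where
    [B = t / ((1 + lam t)^(1 / lam) - 1)], yields [t B' = log_lam (1 + t)] for
    the image [B'] of [B] ([stirling_subst_bernoulli]).  The Bernoulli series
    [B^r (1 + lam t)^(x / lam)] is therefore sent to the Daehee series
    [(log_lam (1 + t) / t)^r (1 + t)^x], and comparing exponential coefficients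
    gives the theorem. *)

Set Implicit Arguments.
Unset Strict Implicit.
Unset Printing Implicit Defensive.

Import Order.TTheory GRing.Theory Num.Theory.

Local Open Scope ring_scope.

Section DegenerateSubstitution.

Variable R : numFieldType.
Implicit Types (a b c u v : fps R) (lam x y : R) (n k m r : nat).

(** * Power series and local linear functionals *)

Lemma eq_fps_mul a a' b b' :
  a =1 a' -> b =1 b' -> fps_mul a b =1 fps_mul a' b'.
Proof. by move=> ea eb n; apply: eq_bigr => i _; rewrite ea eb. Qed.

Lemma eq_fps_exp a b r : a =1 b -> fps_exp a r =1 fps_exp b r.
Proof.
move=> eab; elim: r => [|r IHr] //.
by rewrite /fps_exp !iterS; apply: eq_fps_mul.
Qed.

Definition fps_shift u : fps R := fun n => if n is m.+1 then u m else 0.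

Lemma fps_shift_divt u : u 0%N = 0 -> fps_shift (fps_divt u) =1 u.
Proof. by move=> u0 [|n]. Qed.

Lemma fps_mul_shiftl u v : fps_mul (fps_shift u) v =1 fps_shift (fps_mul u v).
Proof. by case=> [|n]; rewrite /fps_mul big_ord_recl /= mul0r add0r ?big_ord0. Qed.

Lemma fps_mul1l u : fps_mul (@fps_one R) u =1 u.
Proof.
move=> n; rewrite /fps_mul big_ord_recl big1 ?addr0 ?subn0 ?mul1r //.
by move=> i _; rewrite /fps_one /= mul0r.
Qed.

(** Coefficient functionals satisfy both conditions below; locality stands for
    continuity, and reduces a linear functional to finitely many monomials. *)
Definition fps_linear (F : fps R -> R) : Prop :=
  forall u v x, F (fun n => u n + x * v n) = F u + x * F v.

Definition fps_local m (F : fps R -> R) : Prop :=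
  forall u v, (forall k, (k < m)%N -> u k = v k) -> F u = F v.

Lemma fps_mul_linearl v u u' x n :
  fps_mul (fun k => u k + x * u' k) v n = fps_mul u v n + x * fps_mul u' v n.
Proof.
rewrite /fps_mul mulr_sumr -big_split.
by apply: eq_bigr => i _; rewrite mulrDl mulrA.
Qed.

Lemma fps_mul_linearr u v v' x n :
  fps_mul u (fun k => v k + x * v' k) n = fps_mul u v n + x * fps_mul u v' n.
Proof.
rewrite /fps_mul mulr_sumr -big_split.
by apply: eq_bigr => i _; rewrite mulrDr mulrCA.
Qed.

Lemma fps_linear_localE m (F : fps R -> R) :
  fps_linear F -> fps_local m F ->
  forall a, F a = \sum_(k < m) a k * F (fun n => (n == k)%:R).
Proof.
move=> linF locF a.
have F0 : F (fun=> 0) = 0.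
  rewrite (locF _ (fun n => a n + -1 * a n)) ?linF ?mulN1r ?subrr //.
  by move=> k _; rewrite mulN1r subrr.
have trunc p : F (fun k => if (k < p)%N then a k else 0) =
    \sum_(k < p) a k * F (fun n => (n == k)%:R).
  elim: p => [|p IHp]; first by rewrite big_ord0 -[RHS]F0; apply: locF.
  rewrite big_ord_recr /= -IHp -linF; apply: locF => k _.
  rewrite ltnS leq_eqVlt; case: eqVneq => [->|_] /=.
    by rewrite ltnn mulr1 add0r.
  by rewrite mulr0 addr0.
by rewrite -trunc; apply: locF => k ->.
Qed.

(** * The series (1 + lam t)^(x / lam) *)

Lemma natS_neq0 n : n.+1%:R != 0 :> R. Proof. by rewrite pnatr_eq0. Qed.
Lemma fact_neq0 n : n`!%:R != 0 :> R.
Proof. by rewrite pnatr_eq0 -lt0n fact_gt0. Qed.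

Lemma dpow1p_rec lam x n :
  n.+1%:R * dpow1p lam x n.+1 = (x - n%:R * lam) * dpow1p lam x n.
Proof.
rewrite /dpow1p /dfalling big_ord_recr /= factS natrM.
by field; rewrite nat1r natS_neq0 fact_neq0.
Qed.

(** The product satisfies the first-order recurrence [dpow1p_rec] with parameter
    [x + y], seen by splitting the factor [n.+1] as [i + (n.+1 - i)] in the
    convolution. *)
Lemma dpow1pD lam x y :
  fps_mul (dpow1p lam x) (dpow1p lam y) =1 dpow1p lam (x + y).
Proof.
elim=> [|n IHn].
  by rewrite /fps_mul big_ord1 /dpow1p /dfalling !big_ord0 fact0 !divr1 mulr1.
apply: (mulfI (natS_neq0 n)); rewrite dpow1p_rec -IHn /fps_mul mulr_sumr.
transitivity
  (\sum_(i < n.+2) i%:R * dpow1p lam x i * dpow1p lam y (n.+1 - i)%N +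
   \sum_(i < n.+2) dpow1p lam x i *
     ((n.+1 - i)%N%:R * dpow1p lam y (n.+1 - i)%N)).
  rewrite -big_split; apply: eq_bigr => i _ /=.
  have lein : (i <= n.+1)%N by rewrite -ltnS.
  by rewrite -{1}(subnKC lein) natrD; ring.
rewrite [X in X + _]big_ord_recl [X in _ + X]big_ord_recr /=.
rewrite !mul0r add0r subnn mul0r mulr0 addr0 mulr_sumr -big_split.
apply: eq_bigr => i _ /=; rewrite /bump add1n subSS.
have lein : (i <= n)%N by rewrite -ltnS.
rewrite subSn // !dpow1p_rec natrB //.
by ring.
Qed.

Lemma pow1p_dpow1p x : pow1p x =1 dpow1p 1 x.
Proof.
by move=> n; congr (_ / _); apply: eq_bigr => i _; rewrite mulr1.
Qed.

Lemma pow1pD x y : fps_mul (pow1p x) (pow1p y) =1 pow1p (x + y).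
Proof.
move=> n; rewrite pow1p_dpow1p -dpow1pD.
by apply: eq_fps_mul; apply: pow1p_dpow1p.
Qed.

Lemma dpow1p_nat_eq0 lam j k : (j < k)%N -> dpow1p lam (j%:R * lam) k = 0.
Proof.
by move=> ltjk; rewrite /dpow1p /dfalling (bigD1 (Ordinal ltjk)) //= subrr !mul0r.
Qed.

Lemma dpow1p_nat_neq0 lam k : lam != 0 -> dpow1p lam (k%:R * lam) k != 0.
Proof.
move=> lam0; rewrite mulf_neq0 ?invr_eq0 ?fact_neq0 //.
apply/prodf_neq0 => i _.
by rewrite -mulrBl mulf_neq0 // subr_eq0 eqr_nat gtn_eqF.
Qed.

Lemma dpow1p0 lam : dpow1p lam 0 =1 @fps_one R.
Proof.
case=> [|n]; first by rewrite /dpow1p /dfalling big_ord0 divr1.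
by rewrite -[X in dpow1p lam X](mul0r lam) (dpow1p_nat_eq0 lam (j := 0)).
Qed.

Lemma pow1p0 : pow1p 0 =1 @fps_one R.
Proof. by move=> n; rewrite pow1p_dpow1p dpow1p0. Qed.

(** The exponents [x = k * lam] already suffice: [dpow1p lam (k * lam)] has
    coefficients ['C(k, i) * lam ^+ i], so these series form a triangular
    system, and the values of the functional on monomials vanish one after the
    other. *)
Lemma dpow1p_total lam m (F : fps R -> R) :
  lam != 0 -> fps_linear F -> fps_local m F ->
  (forall x, F (dpow1p lam x) = 0) -> forall a, F a = 0.
Proof.
move=> lam0 linF locF F0 a.
suff mono0 k : (k < m)%N -> F (fun n => (n == k)%:R) = 0.
  by rewrite (fps_linear_localE linF locF) big1 // => k _; rewrite mono0 ?mulr0.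
elim/ltn_ind: k => k IHk ltkm.
have := F0 (k%:R * lam); rewrite (fps_linear_localE linF locF).
rewrite (bigD1 (Ordinal ltkm)) //= big1 ?addr0 => [/eqP|i neik].
  by rewrite mulf_eq0 (negPf (dpow1p_nat_neq0 k lam0)) => /eqP.
have [ltik|ltki|eqik] := ltngtP i k.
- by rewrite IHk ?mulr0.
- by rewrite dpow1p_nat_eq0 ?mul0r.
- by case/eqP: neik; apply: val_inj.
Qed.

(** * The substitution operator of a Stirling family *)

(** For degenerate Stirling numbers [S] of the first kind, this is the
    substitution [a |-> a (log_lam (1 + t))], written without powers of the
    logarithm, so that its values on the series [(1 + lam t)^(x / lam)] can be
    read off the definition of [S]. *)
Definition stirling_subst (S : nat -> nat -> R) a : fps R :=
  fun n => n`!%:R^-1 * \sum_(k < n.+1) egf_coef a k * S n k.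

Section Subst.

Variables (lam : R) (S : nat -> nat -> R).
Hypothesis lam_neq0 : lam != 0.
Hypothesis stirlingS : degenerate_stirling1 lam S.

Local Notation Phi := (stirling_subst S).

Lemma stirling_subst_lin n : fps_linear (fun a => Phi a n).
Proof.
move=> u v x; rewrite /stirling_subst mulrCA -mulrDr [x * _]mulr_sumr -big_split.
by congr (_ * _); apply: eq_bigr => i _; rewrite /egf_coef /=; ring.
Qed.

Lemma stirling_subst_local n : fps_local n.+1 (fun a => Phi a n).
Proof.
move=> u v euv; congr (_ * _); apply: eq_bigr => i _.
by rewrite /egf_coef euv.
Qed.

Lemma eq_stirling_subst u v : u =1 v -> Phi u =1 Phi v.
Proof. by move=> euv n; apply: stirling_subst_local => k _. Qed.

Lemma stirling_subst_dpow1p x : Phi (dpow1p lam x) =1 pow1p x.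
Proof.
move=> n; rewrite /stirling_subst /pow1p mulrC; congr (_ / _).
have := congr1 (horner^~ x) (stirlingS n).
rewrite /falling /dfalling horner_prod horner_sum.
under eq_bigr do rewrite hornerD hornerX hornerN -polyC_natr hornerC.
move=> ->; apply: eq_bigr => k _; rewrite hornerZ horner_prod mulrC; congr (_ * _).
rewrite /egf_coef /dpow1p mulrC divfK ?fact_neq0 //.
apply: eq_bigr => i _.
by rewrite -polyC_natr -polyCM hornerD hornerX hornerN hornerC.
Qed.

(** In each degree both sides are bilinear in [(a, b)] and depend on finitely
    many coefficients, so [dpow1p_total] applies first in [a], then in [b], and
    leaves the law of exponents. *)
Lemma stirling_substM a b : Phi (fps_mul a b) =1 fps_mul (Phi a) (Phi b).
Proof.
move=> n; apply/eqP; rewrite -subr_eq0; apply/eqP.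
pose defect u v := Phi (fps_mul u v) n - fps_mul (Phi u) (Phi v) n.
have linl v : fps_linear (defect^~ v).
  move=> u u' x; rewrite /defect.
  rewrite (eq_stirling_subst (fps_mul_linearl v u u' x)) stirling_subst_lin.
  have Phi_lin k := stirling_subst_lin k u u' x.
  by rewrite (eq_fps_mul Phi_lin (frefl _)) fps_mul_linearl; ring.
have linr u : fps_linear (defect u).
  move=> v v' x; rewrite /defect.
  rewrite (eq_stirling_subst (fps_mul_linearr u v v' x)) stirling_subst_lin.
  have Phi_lin k := stirling_subst_lin k v v' x.
  by rewrite (eq_fps_mul (frefl _) Phi_lin) fps_mul_linearr; ring.
have locl v : fps_local n.+1 (defect^~ v).
  move=> u u' euu'; congr (_ - _).
    apply: stirling_subst_local => k ltkn; apply: eq_bigr => i _.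
    by rewrite euu' // (leq_trans (ltn_ord i)).
  apply: eq_bigr => i _; congr (_ * _); apply: stirling_subst_local => k ltki.
  by rewrite euu' // (leq_trans ltki).
have locr u : fps_local n.+1 (defect u).
  move=> v v' evv'; congr (_ - _).
    apply: stirling_subst_local => k ltkn; apply: eq_bigr => i _.
    by rewrite evv' // (leq_ltn_trans (leq_subr _ _)).
  apply: eq_bigr => i _; congr (_ * _); apply: stirling_subst_local => k ltki.
  by rewrite evv' // (leq_trans ltki) // ltnS leq_subr.
apply: (dpow1p_total lam_neq0 (linl b) (locl b)) => x.
apply: (dpow1p_total lam_neq0 (linr _) (locr _)) => y.
rewrite /defect (eq_stirling_subst (dpow1pD lam x y)) stirling_subst_dpow1p.
rewrite -pow1pD; apply/eqP; rewrite subr_eq0; apply/eqP.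
by apply: eq_fps_mul => k; rewrite stirling_subst_dpow1p.
Qed.

Lemma stirling_subst1 : Phi (@fps_one R) =1 @fps_one R.
Proof.
move=> n; rewrite -(eq_stirling_subst (dpow1p0 lam)) stirling_subst_dpow1p.
exact: pow1p0.
Qed.

Lemma stirling_subst_exp a r : Phi (fps_exp a r) =1 fps_exp (Phi a) r.
Proof.
elim: r => [|r IHr]; first exact: stirling_subst1.
by move=> n; rewrite /fps_exp !iterS stirling_substM; apply: eq_fps_mul.
Qed.

Lemma stirling_subst_dpow1p_sub1 x :
  Phi (fps_sub (dpow1p lam x) (@fps_one R)) =1 fps_sub (pow1p x) (@fps_one R).
Proof.
move=> n.
rewrite (@eq_stirling_subst _ (fun k => dpow1p lam x k + -1 * fps_one R k)).
  by rewrite stirling_subst_lin stirling_subst_dpow1p stirling_subst1 mulN1r.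
by move=> k; rewrite mulN1r.
Qed.

Lemma pow1p_sub1 : fps_sub (pow1p 1) (@fps_one R) =1 fps_shift (@fps_one R).
Proof.
rewrite /fps_sub => -[|[|n]]; rewrite pow1p_dpow1p.
- by rewrite /dpow1p /dfalling big_ord0 divr1 subrr.
- by rewrite /dpow1p /dfalling big_ord1 mul0r subr0 divr1 subr0.
- by rewrite -[X in dpow1p 1 X]mul1r (dpow1p_nat_eq0 1 (j := 1)) // subr0.
Qed.

(** Since [lam * t = (1 + lam t)^(lam / lam) - 1], the image of [t] is
    obtained from the exponent [x = lam]. *)
Lemma stirling_subst_t : Phi (fps_shift (@fps_one R)) =1 dlog1p lam.
Proof.
move=> n; apply: (mulfI lam_neq0).
rewrite /dlog1p /fps_scale mulVKf // -stirling_subst_dpow1p_sub1.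
rewrite -[LHS]add0r.
have Phi0 : Phi (fun=> 0) n = 0.
  rewrite /stirling_subst big1 ?mulr0 // => k _.
  by rewrite /egf_coef mulr0 mul0r.
rewrite -Phi0 -stirling_subst_lin; apply: eq_stirling_subst => k.
rewrite add0r /fps_sub; case: k => [|[|k]].
- by rewrite /dpow1p /dfalling big_ord0 divr1 subrr mulr0.
- by rewrite /dpow1p /dfalling big_ord1 mul0r divr1 !subr0 mulr1.
- by rewrite -[X in dpow1p lam X]mul1r (dpow1p_nat_eq0 lam (j := 1)) // subr0 mulr0.
Qed.

(** In [e B = t] the image of [e] is [t] itself, so the image of [B] can be
    recovered by shifting coefficients rather than by a division. *)
Lemma stirling_subst_bernoulli :
  Phi (fps_inv (fps_divt (fps_sub (dpow1p lam 1) (@fps_one R)))) =1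
  fps_divt (dlog1p lam).
Proof.
set e := fps_sub _ _; set B := fps_inv _.
have e0 : e 0%N = 0.
  by rewrite /e /fps_sub /dpow1p /dfalling big_ord0 divr1 subrr.
have e1 : fps_divt e 0%N != 0.
  rewrite /fps_divt /e /fps_sub /dpow1p /dfalling big_ord1 mul0r subr0 divr1.
  by rewrite subr0 oner_neq0.
have eB : fps_mul e B =1 fps_shift (@fps_one R).
  move=> n; rewrite -(eq_fps_mul (fps_shift_divt e0) (frefl B)) fps_mul_shiftl.
  by case: n => //= n; apply: fps_mulrV.
move=> n; rewrite /fps_divt -stirling_subst_t -(eq_stirling_subst eB).
rewrite stirling_substM.
have Phi_e : Phi e =1 fps_shift (@fps_one R).
  by move=> k; rewrite stirling_subst_dpow1p_sub1 pow1p_sub1.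
by rewrite (eq_fps_mul Phi_e (frefl _)) fps_mul_shiftl /= fps_mul1l.
Qed.

End Subst.

End DegenerateSubstitution.

(** * Daehee polynomials from Bernoulli polynomials *)

Theorem theorem3p3 (R : realType) (lam : R) (hlam : lam != 0)
    (S1 : nat -> nat -> R) (hS1 : degenerate_stirling1 lam S1)
    (r : nat) (hr : (1 <= r)%N) (x : R) (n : nat) :
  degenerate_daehee lam r n x =
  \sum_(k < n.+1) degenerate_bernoulli lam r k x * S1 n k.
Proof.
set B := fps_mul (fps_exp (fps_inv (fps_divt
  (fps_sub (dpow1p lam 1) (@fps_one R)))) r) (dpow1p lam x).
transitivity (n`!%:R * stirling_subst S1 B n); last first.
  by rewrite /stirling_subst mulVKf ?fact_neq0.
congr (_ * _); rewrite (stirling_substM hlam hS1).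
apply: eq_fps_mul => k; last by rewrite (stirling_subst_dpow1p hS1).
rewrite (stirling_subst_exp hlam hS1).
by apply: eq_fps_exp => i; rewrite (stirling_subst_bernoulli hlam hS1).
Qed.
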